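(* Let $f$ be a polynomial with real coefficients of degree $n\ge 2$, with $n$ even. Then there exist points $P_1,P_2$ of the plane, not on the graph of $f$, such that $I_f(P_1)=0$ and $I_f(P_2)=2$.
   Context: For a differentiable function $f$ on $\mathbb{R}$ and a point $P$ not on the graph of $f$, the illumination index $I_f(P)$ is the number of distinct lines that are tangent to the graph of $f$ (i.e. lines $y=f(c)+f'(c)(x-c)$ for some $c\in\mathbb{R}$) and pass through $P$; a line tangent at several points is counted once. The value $\infty$ is allowed in general. *)

(* Defs.v *)
From mathcomp Require Import all_boot all_order all_algebra.
From mathcomp Require Import all_classical all_reals all_analysis.
Import numFieldNormedType.Exports.

Set Implicit Arguments.
Unset Strict Implicit.
Unset Printing Implicit Defensive.

Local Open Scope classical_set_scope.
Local Open Scope ring_scope.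

Definition graph_of (R : realType) (f : R -> R) : set (R * R) :=
  [set Q | Q.2 = f Q.1].

Definition tangent_line (R : realType) (f : R -> R) (c : R) : set (R * R) :=
  [set Q | Q.2 = f c + derive1 f c * (Q.1 - c)].

(* Lines are point sets, so a line tangent at several points is one element. *)
Definition tangents_through (R : realType) (f : R -> R) (P : R * R)
    : set (set (R * R)) :=
  [set L | (exists c : R, L = tangent_line f c) /\ L P].

(* [derive1] is total: the index has its usual meaning for differentiable [f]
   and [P] off the graph of [f]. *)
Definition illumination_index (R : realType) (f : R -> R) (P : R * R)
    : \bar R :=
  counting (tangents_through f P).

(* Main.v *)
Require Import Defs.
From mathcomp Require Import all_boot all_order all_algebra.
From mathcomp Require Import all_classical all_reals all_analysis.
From mathcomp Require Import polyorder polyrcf.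
From mathcomp Require Import ring lra.
Import Order.TTheory GRing.Theory Num.Theory.

Local Open Scope classical_set_scope.
Local Open Scope ring_scope.

(** Let [l] be the leading coefficient and [n] the degree of [f].  The tangent
    at [c] meets the vertical axis at height [g c = f c - c * f' c], so the
    lines through [(0, b)] tangent to the graph are the tangents at the
    solutions of [g c = b].  The polynomial [g] has degree [n] and leading
    coefficient [(1 - n) * l]; as [n] is even, [g] tends to the same infinity
    at both ends, say to minus infinity after replacing [f] by [- f] if
    necessary ([yintercept_levels]).

    Hence [g] is bounded above, and a point [(0, b)] with [b] above every value
    of [g] lies on no tangent.  Conversely [g' x = - x * f'' x], where [f'']
    is positive far out, so [g] is strictly monotone on two opposite rays
    ([yintercept_ray]) and bounded in between; every sufficiently low level [b]
    is therefore reached exactly once on each ray and nowhere else.  The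
    two tangents found this way are different lines because [f'], of odd
    degree, is negative far to the left and positive far to the right.
    Finally [g 0 = f 0], so a level that [g] avoids near [0] gives a
    point off the graph. *)

(** * Heights of tangents on the vertical axis *)

(** The height at which the tangent to the graph of [p] at [c] meets the
    vertical axis, as a polynomial in [c]. *)
Definition yintercept (R : nzRingType) (p : {poly R}) : {poly R} :=
  p - 'X * p^`().
Arguments yintercept {R} p.

Lemma yinterceptN (R : nzRingType) (p : {poly R}) :
  yintercept (- p) = - yintercept p.
Proof. by rewrite /yintercept derivN mulrN opprB opprK addrC. Qed.

Lemma horner_yintercept (R : comNzRingType) (p : {poly R}) (c : R) :
  (yintercept p).[c] = p.[c] - c * p^`().[c].
Proof. by rewrite /yintercept !hornerE. Qed.

Lemma deriv_yintercept (R : nzRingType) (p : {poly R}) :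
  (yintercept p)^`() = - ('X * p^`()^`()).
Proof.
by rewrite /yintercept derivB derivM derivX mul1r opprD addrA subrr add0r.
Qed.

Lemma coef_yintercept (R : nzRingType) (p : {poly R}) (i : nat) :
  (yintercept p)`_i = p`_i - p`_i *+ i.
Proof.
by rewrite /yintercept coefB coefXM coef_deriv; case: i => [|i]; rewrite ?mulr0n.
Qed.

Section RealField.
Variable R : realFieldType.
Implicit Type p : {poly R}.

Lemma lead_coef_deriv p : (1 < size p)%N ->
  lead_coef p^`() = lead_coef p *+ (size p).-1.
Proof.
by rewrite !lead_coefE size_deriv coef_deriv; case: (size p) => [|[]].
Qed.

Lemma lead_coef_deriv_gt0 p :
  (1 < size p)%N -> 0 < lead_coef p -> 0 < lead_coef p^`().
Proof.
move=> sp lp; rewrite lead_coef_deriv// pmulrn_lgt0//.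
by rewrite -ltnS prednK// ltnW.
Qed.


(** The degree is kept: the top coefficient is multiplied by [1 - n], where
    [n] is the degree of [p], and [n] is at least 2. *)
Lemma size_lead_coef_yintercept p : (2 < size p)%N ->
  size (yintercept p) = size p /\
  lead_coef (yintercept p) = - (lead_coef p *+ (size p).-2).
Proof.
move=> sp.
have topE : (yintercept p)`_(size p).-1 = - (lead_coef p *+ (size p).-2).
  rewrite coef_yintercept -lead_coefE.
  by case: (size p) sp => [|[|m]]//= _; rewrite mulrS; ring.
have szE : size (yintercept p) = size p.
  apply/anti_leq/andP; split.
    apply/leq_sizeP => j pj; rewrite coef_yintercept nth_default//.
    by rewrite mul0rn subrr.
  rewrite -[leqLHS]prednK; last by rewrite (leq_trans _ sp).
  rewrite ltnNge; apply/negP => /leq_sizeP/(_ _ (leqnn _)).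
  rewrite topE => /eqP; rewrite oppr_eq0 mulrn_eq0 lead_coef_eq0 -size_poly_eq0.
  by case: (size p) sp => [|[|[]]].
by split; rewrite // lead_coefE szE.
Qed.

End RealField.

(** * Levels of the height polynomial in even degree *)

Section RealClosedField.
Variable R : rcfType.
Implicit Type p : {poly R}.

(** Far to the right both [p'] and [p''] are positive, hence
    [(yintercept p)' = - 'X * p''] is negative there. *)
Lemma yintercept_ray p : (2 < size p)%N -> 0 < lead_coef p ->
  exists M : R,
    [/\ 0 < M,
        forall x, M <= x -> 0 < p^`().[x],
        forall x y, M <= x -> x < y ->
          (yintercept p).[y] < (yintercept p).[x]
      & forall b, b <= (yintercept p).[M] ->
          exists2 c, M <= c & (yintercept p).[c] = b].
Proof.
move=> sp lp.
have lp1 : 0 < lead_coef p^`() by apply: lead_coef_deriv_gt0 => //; exact: ltnW.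
have lp2 : 0 < lead_coef p^`()^`().
  apply: lead_coef_deriv_gt0 => //.
  by rewrite size_deriv; case: (size p) sp => [|[|[]]].
have [m1 m1P] := poly_pinfty_gt_lc lp1.
have [m2 m2P] := poly_pinfty_gt_lc lp2.
(* The lower bound 1 keeps the factor [- 'X] of the derivative negative. *)
pose M := Num.max 1 (Num.max m1 m2).
have [M1 M2 M0] : [/\ m1 <= M, m2 <= M & 0 < M].
  by rewrite /M !le_max !lexx !orbT lt_max ltr01.
have decr x y : M <= x -> x < y -> (yintercept p).[y] < (yintercept p).[x].
  move=> Mx xy; rewrite -ltrN2 -!hornerN.
  apply: (@ltr_hornerW _ _ x y) => //; rewrite ?in_itv/= ?lexx ?(ltW xy)//.
  move=> z; rewrite in_itv/= => /andP[xz _].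
  have Mz : M <= z by rewrite (le_trans Mx)// ltW.
  rewrite derivN deriv_yintercept opprK hornerM hornerX mulr_gt0//.
    exact: lt_le_trans Mz.
  by apply: lt_le_trans lp2 _; apply: m2P; exact: le_trans Mz.
exists M; split => // [x Mx|b bM].
  by apply: lt_le_trans lp1 _; apply: m1P; exact: le_trans Mx.
have [szY leadY] := size_lead_coef_yintercept _ p sp.
have [m mP] : exists m, forall x, m <= x -> - b <= (- yintercept p).[x].
  apply: poly_lim_infty; last by rewrite size_polyN szY ltnW.
  rewrite lead_coefN leadY opprK pmulrn_lgt0//.
  by case: (size p) sp => [|[|[]]].
pose N := Num.max m M.
have MN : M <= N by rewrite le_max lexx orbT.
have bN : (yintercept p).[N] <= b.
  by rewrite -lerN2 -hornerN; apply: mP; rewrite le_max lexx.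
have levelE x : (b%:P - yintercept p).[x] = b - (yintercept p).[x].
  by rewrite hornerD hornerC hornerN.
have [|c] := @poly_ivt _ (b%:P - yintercept p) M N MN.
  by rewrite !levelE subr_le0 subr_ge0 bM.
move=> /andP[Mc _]; rewrite /root levelE subr_eq0 => /eqP bE.
by exists c.
Qed.

(** Reflecting the graph in the vertical axis preserves the heights at which
    its tangents cross that axis. *)
Lemma comp_polyNX_yintercept p (x : R) :
  (yintercept (p \Po - 'X)).[x] = (yintercept p).[- x].
Proof.
rewrite !horner_yintercept deriv_comp derivN derivX hornerM !horner_comp.
by rewrite !hornerE /= mulrN1 mulNr.
Qed.

(** Reflecting in the vertical axis turns the left ray into a right ray for
    [p \Po - 'X], whose leading coefficient is still positive because the
    degree is even. Between the two rays [yintercept p] is bounded by some [B],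
    and [B + 1] and [- (B + 1)] serve as the two levels. *)
Lemma yintercept_levels_pos p : (2 < size p)%N -> odd (size p) ->
    0 < lead_coef p ->
  exists b1 b2 c1 c2 : R,
    [/\ forall c, (yintercept p).[c] != b1,
        forall c, (yintercept p).[c] = b2 <-> c = c1 \/ c = c2,
        p^`().[c1] != p^`().[c2]
      & b2 != p.[0]].
Proof.
move=> sp ep lp; set g := yintercept p.
have szNX : size (- 'X : {poly R}) = 2 by rewrite size_polyN size_polyX.
have [M [M0 pM decM surjM]] := yintercept_ray p sp lp.
have [|| M' [M'0 pM' decM' surjM']] := yintercept_ray (p \Po - 'X).
- by rewrite size_comp_poly2.
- rewrite lead_coef_comp ?szNX// lead_coefN lead_coefX -signr_odd.
  by case: (size p) ep sp => //= k /negbTE-> _; rewrite expr0 mulr1.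
have [B gB] := poly_disk_bound g (Num.max M M').
have gM : `|g.[M]| <= B by rewrite gB// gtr0_norm// le_max lexx.
have gM' : `|g.[- M']| <= B by rewrite gB// normrN gtr0_norm// le_max lexx orbT.
have g0 : `|g.[0]| <= B by rewrite gB// normr0 le_max ltW.
have cases c : [\/ `|c| <= Num.max M M', M <= c | M' <= - c].
  have [|] := leP `|c| (Num.max M M'); first by constructor.
  rewrite gt_max => /andP[Mc M'c].
  have [c0|c0] := leP 0 c; first by rewrite ger0_norm// in Mc; constructor 2; exact: ltW.
  by rewrite ltr0_norm// in M'c; constructor 3; exact: ltW.
have decrL x y : M' <= x -> x < y -> g.[- y] < g.[- x].
  by rewrite -!comp_polyNX_yintercept; exact: decM'.
have [c2 Mc2 gc2] : exists2 c, M <= c & g.[c] = - (B + 1).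
  by apply: surjM; rewrite -/g; move: gM; rewrite ler_norml => /andP[]; lra.
have [c1 Mc1 gc1] : exists2 c, M' <= c & g.[- c] = - (B + 1).
  have [|c cM] := surjM' (- (B + 1)).
    rewrite comp_polyNX_yintercept -/g.
    by move: gM'; rewrite ler_norml => /andP[]; lra.
  by rewrite comp_polyNX_yintercept; exists c.
exists (B + 1), (- (B + 1)), (- c1), c2; split.
- move=> c; rewrite lt_eqF//; apply: (@le_lt_trans _ _ B); last by rewrite ltrDl.
  have le_normB x : `|x| <= B -> x <= B by exact/le_trans/ler_norm.
  case: (cases c) => [/gB/le_normB//|Mc|Mc].
    apply: (le_trans _ (le_normB _ gM)); move: Mc; rewrite le_eqVlt.
    by case/predU1P => [->//|/(decM _ _ (lexx _))/ltW].
  apply: (le_trans _ (le_normB _ gM')); move: Mc; rewrite le_eqVlt.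
  case/predU1P => [->|/(decrL _ _ (lexx _))/ltW]; first by rewrite opprK.
  by rewrite opprK.
- move=> c; split=> [gc|[]->//].
  case: (cases c) => [/gB|Mc|Mc].
  + by rewrite gc ler_norml => /andP[]; lra.
  + right; have [cc|cc|//] := ltgtP c c2.
      by have := decM _ _ Mc cc; rewrite -/g gc gc2 ltxx.
    by have := decM _ _ Mc2 cc; rewrite -/g gc gc2 ltxx.
  + left; rewrite -[c]opprK; congr (- _); have [cc|cc|//] := ltgtP (- c) c1.
      by have := decrL _ _ Mc cc; rewrite opprK gc gc1 ltxx.
    by have := decrL _ _ Mc1 cc; rewrite opprK gc gc1 ltxx.
- rewrite lt_eqF//; apply: (@lt_trans _ _ 0); last exact: pM.
  have := pM' _ Mc1; rewrite deriv_comp derivN derivX hornerM horner_comp.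
  by rewrite !hornerE mulrN1 oppr_gt0.
- have -> : p.[0] = g.[0] by rewrite horner_yintercept mul0r subr0.
  by apply/eqP => bE; move: g0; rewrite -bE ler_norml => /andP[]; lra.
Qed.

(** A negative leading coefficient is reduced to a positive one by reflecting in
    the horizontal axis, which negates both levels and both slopes. *)
Lemma yintercept_levels p : (2 < size p)%N -> odd (size p) ->
  exists b1 b2 c1 c2 : R,
    [/\ forall c, (yintercept p).[c] != b1,
        forall c, (yintercept p).[c] = b2 <-> c = c1 \/ c = c2,
        p^`().[c1] != p^`().[c2]
      & b2 != p.[0]].
Proof.
move=> sp ep; have [lp|lp|lp] := ltgtP 0 (lead_coef p).
- exact: yintercept_levels_pos.
- have [| | |b1 [b2 [c1 [c2 [gb1 gb2 slopes b20]]]]] := yintercept_levels_pos (- p).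
  + by rewrite size_polyN.
  + by rewrite size_polyN.
  + by rewrite lead_coefN oppr_gt0.
  exists (- b1), (- b2), c1, c2; split.
  + by move=> c; rewrite -eqr_oppLR -hornerN -yinterceptN.
  + move=> c; rewrite -gb2 yinterceptN hornerN.
    by split=> [->|<-]; rewrite opprK.
  + by move: slopes; rewrite derivN !hornerN eqr_opp.
  + by rewrite eqr_oppLR -hornerN.
- by move/esym/eqP: lp; rewrite lead_coef_eq0 -size_poly_eq0; case: (size p) sp.
Qed.

End RealClosedField.

(** * Tangent lines through points of the vertical axis *)

Lemma tangents_through_axis (R : realType) (p : {poly R}) (b : R) :
  tangents_through (horner p) (0, b) =
  tangent_line (horner p) @` [set c | (yintercept p).[c] = b].
Proof.
apply/seteqP; split=> [L [[c ->]]|L [c /= gc <-]] /=; last first.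
  split; first by exists c.
  by rewrite /tangent_line/= -derivE -gc horner_yintercept; ring.
rewrite /tangent_line/= -derivE => bE; exists c => //=.
by rewrite bE horner_yintercept; ring.
Qed.

(** A tangent line is not vertical, so as a point set it determines its slope;
    comparing abscissas 0 and 1 recovers it. *)
Lemma tangent_line_slope (R : realType) (f : R -> R) (c d : R) :
  tangent_line f c = tangent_line f d -> derive1 f c = derive1 f d.
Proof.
move=> eqL.
have on x : f c + derive1 f c * (x - c) = f d + derive1 f d * (x - d).
  have : tangent_line f c (x, f c + derive1 f c * (x - c)) by [].
  by rewrite eqL.
by have := on 0; have := on 1; lra.
Qed.

Theorem theorem3p3 (R : realType) (n : nat) (f : {poly R})
    (hn : (2 <= n)%N) (hev : ~~ odd n) (hdeg : size f = n.+1) :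
  exists P1 P2 : R * R,
    [/\ ~ graph_of (horner f) P1,
        ~ graph_of (horner f) P2,
        illumination_index (horner f) P1 = 0%:E
      & illumination_index (horner f) P2 = 2%:E].
Proof.
have [||b1 [b2 [c1 [c2 [gb1 gb2 slopes b20]]]]] := yintercept_levels R f.
- by rewrite hdeg.
- by rewrite hdeg.
have g0 : (yintercept f).[0] = f.[0] by rewrite horner_yintercept mul0r subr0.
exists (0, b1), (0, b2); split.
- by rewrite /graph_of/= => b1E; have := gb1 0; rewrite g0 b1E eqxx.
- by rewrite /graph_of/= => b2E; rewrite b2E eqxx in b20.
- rewrite /illumination_index tangents_through_axis.
  have -> : [set c | (yintercept f).[c] = b1] = set0.
    by apply/seteqP; split=> // c /= /eqP; rewrite (negbTE (gb1 c)).
  by rewrite image_set0 /counting asboolT// fset_set0.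
- rewrite /illumination_index tangents_through_axis.
  have -> : [set c | (yintercept f).[c] = b2] = [set c1; c2].
    by apply/seteqP; split=> c /=; rewrite gb2.
  rewrite image_setU !image_set1 /counting asboolT//.
  rewrite fset_setU1// fset_set1 finmap.cardfs2.
  have [/tangent_line_slope|//] := eqVneq.
  by rewrite -!derivE => /eqP; rewrite (negbTE slopes).
Qed.
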